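(* Let $\mathcal{T}_h$ be a triangular mesh of $\Omega$ satisfying the anisotropic non-obtuse angle condition $$(\boldsymbol{q}_i^K)^T\,\mathbb{D}_K\,\boldsymbol{q}_j^K\le0\qquad\text{for all } i\ne j,\ i,j\in\{1,2,3\},\ \text{and all } K\in\mathcal{T}_h .$$ Then for every interior edge $e_{ij}$ of $\mathcal{T}_h$, with $K$ and $K'$ denoting the two elements sharing $e_{ij}$, $$\frac{1}{2}\left[\alpha_{ij,\mathbb{D}_K^{-1}}^{K}+\alpha_{ij,\mathbb{D}_{K'}^{-1}}^{K'}+\operatorname{arccot}\left(\sqrt{\frac{\det(\mathbb{D}_K)}{\det(\mathbb{D}_{K'})}}\,\cot\big(\alpha_{ij,\mathbb{D}_K^{-1}}^{K}\big)\right)+\operatorname{arccot}\left(\sqrt{\frac{\det(\mathbb{D}_{K'})}{\det(\mathbb{D}_{K})}}\,\cot\big(\alpha_{ij,\mathbb{D}_{K'}^{-1}}^{K'}\big)\right)\right]\le\pi .$$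
   Context: $\Omega\subset\mathbb{R}^2$ is a connected polygonal domain and $\mathbb{D}=\mathbb{D}(x,y)$ is a $2\times2$ matrix-valued function that is symmetric and strictly positive definite on $\Omega$ (including the points where it is evaluated below). $\mathcal{T}_h$ is a conforming (edge-to-edge) triangulation of $\Omega$ by nondegenerate triangles (elements). An interior edge is an edge shared by two elements; $e_{ij}$ denotes the edge connecting the vertices $\boldsymbol{a}_i$ and $\boldsymbol{a}_j$. Quadrature: a quadrature rule on the reference triangle $\hat K$ is fixed, with nodes $\hat b_k\in\hat K$ and weights $\hat w_k\ge0$, $k=1,\dots,m$, $\sum_{k=1}^m\hat w_k=1$. For each element $K$, $F_K:\hat K\to K$ is the affine map with $F_K(\hat K)=K$, $b_k^K=F_K(\hat b_k)$, and $\mathbb{D}_K=\sum_{k=1}^m\hat w_k\,\mathbb{D}(b_k^K)$, a symmetric positive definite constant matrix. For an element $K$ with vertices $\boldsymbol{a}_1^K,\boldsymbol{a}_2^K,\boldsymbol{a}_3^K$, let $E_K=[\boldsymbol{a}_2^K-\boldsymbol{a}_1^K,\ \boldsymbol{a}_3^K-\boldsymbol{a}_1^K]$ (a nonsingular $2\times2$ matrix), and define the vectors $\boldsymbol{q}_i^K$ by $[\boldsymbol{q}_2^K,\boldsymbol{q}_3^K]=E_K^{-T}$ and $\boldsymbol{q}_1^K=-\boldsymbol{q}_2^K-\boldsymbol{q}_3^K$. Angles: for an element $K$ with vertices $\boldsymbol{a}_i^K,\boldsymbol{a}_j^K,\boldsymbol{a}_k^K$, the angle opposite the edge $e_{ij}$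 measured in the metric $\mathbb{D}_K^{-1}$ is $$\alpha_{ij,\mathbb{D}_K^{-1}}^K=\arccos\left(\frac{(\boldsymbol{a}_i^K-\boldsymbol{a}_k^K)^T\mathbb{D}_K^{-1}(\boldsymbol{a}_j^K-\boldsymbol{a}_k^K)}{\|\boldsymbol{a}_i^K-\boldsymbol{a}_k^K\|_{\mathbb{D}_K^{-1}}\,\|\boldsymbol{a}_j^K-\boldsymbol{a}_k^K\|_{\mathbb{D}_K^{-1}}}\right)\in(0,\pi),\qquad \|\boldsymbol{v}\|_{M}=\sqrt{\boldsymbol{v}^TM\boldsymbol{v}}.$$ The function $\operatorname{arccot}$ takes values in $(0,\pi)$. *)

(* Defs.v *)
From HB Require Import structures.
From mathcomp Require Import all_boot all_order all_algebra.
From mathcomp Require Import all_classical all_reals all_analysis.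

Set Implicit Arguments.
Unset Strict Implicit.
Unset Printing Implicit Defensive.

Import Order.TTheory GRing.Theory Num.Theory numFieldNormedType.Exports.

Local Open Scope classical_set_scope.
Local Open Scope ring_scope.

Notation plane R := 'cV[R]_2.

Definition cot {R : realType} (x : R) : R := cos x / sin x.

(* The inverse of cot on the whole of ]0, pi[ (not the odd variant
   atan x^-1): see arccot_itv and arccotK. *)
Definition arccot {R : realType} (x : R) : R := pi / 2 - atan x.

Lemma arccot_itv (R : realType) (x : R) : 0 < arccot x < pi.
Proof.
have h1 := atan_gtNpi2 x; have h2 := atan_ltpi2 x.
by rewrite /arccot subr_gt0 h2 /= {2}[pi]splitr ltrD2l ltrNl.
Qed.

Lemma arccotK (R : realType) : cancel (@arccot R) cot.
Proof.
move=> x; rewrite /cot /arccot.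
have -> : pi / 2 - atan x = - (atan x - pi / 2) by rewrite opprB.
by rewrite cosN sinN cosBpihalf sinBpihalf opprK -/(tan _) atanK.
Qed.

Definition spd {R : realType} n (M : 'M[R]_n) : Prop :=
  M^T = M /\ forall v : 'cV[R]_n, v != 0 -> 0 < (v^T *m M *m v) 0 0.

Definition dotM {R : realType} n (M : 'M[R]_n) (u v : 'cV[R]_n) : R :=
  (u^T *m M *m v) 0 0.

Definition normM {R : realType} n (M : 'M[R]_n) (v : 'cV[R]_n) : R :=
  Num.sqrt (dotM M v v).

(* Angle at r, in the metric M, of the triangle p q r; it is opposite to the
   edge pq. *)
Definition angle {R : realType} (M : 'M[R]_2) (p q r : plane R) : R :=
  acos (dotM M (p - r) (q - r) / (normM M (p - r) * normM M (q - r))).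

Definition segment {R : realType} (p q : plane R) : set (plane R) :=
  [set x | exists t : R, 0 <= t <= 1 /\ x = (1 - t) *: p + t *: q].

Definition triangle {R : realType} (t : 'I_3 -> plane R) : set (plane R) :=
  [set x | exists c : 'I_3 -> R, [/\ forall i, 0 <= c i,
     \sum_i c i = 1 & x = \sum_i c i *: t i]].

(* [t_1 - t_0, t_2 - t_0] *)
Definition edge_mx {R : realType} (t : 'I_3 -> plane R) : 'M[R]_2 :=
  \matrix_(r, c) (t (lift ord0 c) - t ord0) r 0.

Definition nondegenerate_triangle {R : realType} (t : 'I_3 -> plane R) : Prop :=
  edge_mx t \in unitmx.

(* For i = lift ord0 c, q_vec t i is column c of the inverse transpose of
   edge_mx t; the three vectors q_vec t i add up to 0. *)
Definition q_vec {R : realType} (t : 'I_3 -> plane R) (i : 'I_3) : plane R :=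
  let Q := (invmx (edge_mx t))^T in
  if unlift ord0 i is Some c then col c Q else - \sum_c col c Q.

Definition affine_map {R : realType} (f : plane R -> plane R) : Prop :=
  exists (A : 'M[R]_2) (b : plane R), forall x, f x = A *m x + b.

Definition polygonal_domain {R : realType} (Omega : set (plane R)) : Prop :=
  [/\ open Omega, Omega !=set0, connected Omega, bounded_set Omega &
    exists s : seq (plane R * plane R),
      closure Omega `\` Omega
      = [set x | exists e, [/\ e \in s, e.1 != e.2 & segment e.1 e.2 x]]].

(* An element is the (ordered) triple of the indices of its vertices. *)
Record mesh (R : realType) := Mesh {
  nvtx : nat;
  vtx : 'I_nvtx -> plane R;
  elts : {set {ffun 'I_3 -> 'I_nvtx}} }.

Definition eltpts {R : realType} (T : mesh R) (K : {ffun 'I_3 -> 'I_(nvtx T)})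
  : 'I_3 -> plane R := fun i => vtx (K i).

Definition verts {n : nat} (K : {ffun 'I_3 -> 'I_n}) : {set 'I_n} :=
  [set K l | l in 'I_3].

(* By the last clause two distinct elements are disjoint, or share exactly one
   vertex, or share exactly one edge; in particular they cannot be two
   orderings of the same triangle. *)
Definition conforming_triangulation {R : realType}
    (Omega : set (plane R)) (T : mesh R) : Prop :=
  [/\ injective (@vtx R T),
      forall i : 'I_(nvtx T), exists2 K, K \in elts T & i \in verts K,
      forall K, K \in elts T -> nondegenerate_triangle (eltpts K),
      closure Omega
      = [set x | exists2 K, K \in elts T & triangle (eltpts K) x] &
      forall K K', K \in elts T -> K' \in elts T -> K != K' ->
        let I := triangle (eltpts K) `&` triangle (eltpts K') in
        [\/ I = set0,
            exists i, [/\ i \in verts K, i \in verts K' & I = [set vtx i]] |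
            exists i j, [/\ i != j, [set i; j]%SET \subset verts K,
                            [set i; j]%SET \subset verts K' &
                            I = segment (vtx i) (vtx j)]]].

(* Quadrature average of D over the image of the reference triangle by F. *)
Definition avg_diff {R : realType} (D : plane R -> 'M[R]_2) m
    (w : 'I_m -> R) (bhat : 'I_m -> plane R) (F : plane R -> plane R)
    : 'M[R]_2 :=
  \sum_(k < m) w k *: D (F (bhat k)).

(* Main.v *)
(** By 2x2 linear algebra, the inner product (a_i - a_k)^T D^-1 (a_j - a_k) is a
    negative multiple of q_i^T D q_j, so the hypothesis says that every angle is
    at most pi/2.  Its cotangent is then nonnegative, so each of the four terms
    in the bracket is at most pi/2. *)
Require Import Defs.
From HB Require Import structures.
From mathcomp Require Import all_boot all_order all_algebra.
From mathcomp Require Import all_classical all_reals all_analysis.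
From mathcomp Require Import ring lra.

Set Implicit Arguments.
Unset Strict Implicit.
Unset Printing Implicit Defensive.

Import Order.TTheory GRing.Theory Num.Theory numFieldNormedType.Exports.

Local Open Scope classical_set_scope.
Local Open Scope ring_scope.

Section QuadraticForm.
Variable R : realType.

Lemma dotM2E (M : 'M[R]_2) (u v : 'cV[R]_2) :
  dotM M u v = u 0 0 * M 0 0 * v 0 0 + u 0 0 * M 0 1 * v 1 0
             + u 1 0 * M 1 0 * v 0 0 + u 1 0 * M 1 1 * v 1 0.
Proof.
have lift01 : lift ord0 ord0 = 1 :> 'I_2 by apply/val_inj.
by rewrite /dotM !(mxE, big_ord_recl, big_ord0) !lift01; ring.
Qed.

Lemma det_mx22 (M : 'M[R]_2) : \det M = M 0 0 * M 1 1 - M 0 1 * M 1 0.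
Proof.
have l01 : lift 0 0 = 1 :> 'I_2 by apply/val_inj.
have l10 : lift 1 0 = 0 :> 'I_2 by apply/val_inj.
rewrite (expand_det_row M 0) !big_ord_recl big_ord0 l01 /cofactor !det_mx11 !mxE.
by rewrite l01 l10 /= expr0 expr1; ring.
Qed.

Lemma invmx2E (M : 'M[R]_2) : \det M != 0 ->
  [/\ invmx M 0 0 = M 1 1 / \det M, invmx M 0 1 = - M 0 1 / \det M,
      invmx M 1 0 = - M 1 0 / \det M & invmx M 1 1 = M 0 0 / \det M].
Proof.
move=> Mn0; have Mu : M \in unitmx by rewrite unitmxE unitfE.
have l01 : lift 0 0 = 1 :> 'I_2 by apply/val_inj.
have l10 : lift 1 0 = 0 :> 'I_2 by apply/val_inj.
rewrite /invmx Mu; split; rewrite !mxE /cofactor det_mx11 !mxE ?l01 ?l10 /=;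
  by field.
Qed.

Lemma spd_sym2 (M : 'M[R]_2) : spd M -> M 1 0 = M 0 1.
Proof. by case=> Ms _; rewrite -[in LHS]Ms mxE. Qed.

Lemma spd_det2_gt0 (M : 'M[R]_2) : spd M -> 0 < \det M.
Proof.
move=> Mspd; have Ms := spd_sym2 Mspd; case: Mspd => _ Mpos.
have Mp (v : 'cV[R]_2) : v != 0 -> 0 < dotM M v v by exact: Mpos.
have M0 : 0 < M 0 0.
  have /Mp : delta_mx 0 0 != 0 :> 'cV[R]_2.
    by apply/eqP => /matrixP/(_ 0 0)/eqP; rewrite !mxE /= oner_eq0.
  by rewrite dotM2E !mxE /= !(mul0r, mulr0, mul1r, mulr1, addr0).
(* The first row of [M] annihilates [v], so [M *m v] has entries 0 and [\det M], and the form takes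
   the value [M 0 0 * \det M] at [v]. *)
pose v : 'cV[R]_2 := \col_r (if r == 0 then - M 0 1 else M 0 0).
have /Mp : v != 0.
  by apply/eqP => /matrixP/(_ 1 0)/eqP; rewrite !mxE /= (gt_eqF M0).
rewrite dotM2E !mxE /= Ms => h.
have: 0 < M 0 0 * \det M by rewrite det_mx22 Ms; lra.
by rewrite pmulr_rgt0.
Qed.

Lemma spd_invmx2 (M : 'M[R]_2) : spd M -> spd (invmx M).
Proof.
move=> Mspd; have Mu : M \in unitmx by rewrite unitmxE unitfE gt_eqF ?spd_det2_gt0.
case: Mspd => Ms Mp; split=> [|v v0]; first by rewrite trmx_inv Ms.
(* By symmetry, the form of [invmx M] at [v] is the form of [M] at [invmx M *m v]. *)
have := Mp (invmx M *m v); rewrite trmx_mul trmx_inv Ms.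
rewrite -!mulmxA mulKVmx //; apply.
by apply: contra v0 => /eqP h; rewrite -[v](mulKVmx Mu) h mulmx0.
Qed.

(** Cauchy-Schwarz in the metric [M]; it keeps the argument of [acos] in [angle] at most 1. *)
Lemma spd_dot_le_norm2 (M : 'M[R]_2) (u v : 'cV[R]_2) :
  spd M -> dotM M u v <= normM M u * normM M v.
Proof.
move=> Mspd; have Ms := spd_sym2 Mspd; have Md := spd_det2_gt0 Mspd.
have dot_ge0 x : 0 <= dotM M x x.
  have [->|x0] := eqVneq x 0; first by rewrite /dotM mulmx0 mxE.
  exact/ltW/Mspd.2.
rewrite /normM -sqrtrM //; apply: le_trans (ler_norm _) _.
rewrite -sqrtr_sqr ler_wsqrtr // -subr_ge0.
(* Lagrange's identity *)
have -> : dotM M u u * dotM M v v - dotM M u v ^+ 2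
    = \det M * (u 0 0 * v 1 0 - u 1 0 * v 0 0) ^+ 2.
  by rewrite !dotM2E det_mx22 Ms; ring.
by rewrite mulr_ge0 ?sqr_ge0 // ltW.
Qed.

Lemma spd_avg n m (w : 'I_m -> R) (A : 'I_m -> 'M[R]_n) :
    (forall k, 0 <= w k) -> \sum_k w k = 1 -> (forall k, spd (A k)) ->
  spd (\sum_k w k *: A k).
Proof.
move=> w0 w1 Aspd; split=> [|v v0].
  by rewrite linear_sum; apply: eq_bigr => k _; rewrite linearZ /= (Aspd k).1.
have -> : (v^T *m (\sum_k w k *: A k) *m v) 0 0
    = \sum_k w k * (v^T *m A k *m v) 0 0.
  rewrite mulmx_sumr mulmx_suml summxE; apply: eq_bigr => k _.
  by rewrite -scalemxAr -scalemxAl mxE.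
have t0 k : 0 <= w k * (v^T *m A k *m v) 0 0.
  by rewrite mulr_ge0 // ltW // (Aspd k).2.
(* Single weights may vanish, so positivity is argued on the whole sum: if it were 0, each of its
   nonnegative terms would be 0, hence every weight, against their total of 1. *)
rewrite lt0r sumr_ge0 // andbT psumr_eq0 //; apply/negP => /allP h.
move: w1; rewrite big1 => [/eqP|k _]; first by rewrite eq_sym oner_eq0.
have := h k (mem_index_enum k); rewrite mulf_eq0 => /orP[/eqP //|].
by rewrite gt_eqF // (Aspd k).2.
Qed.

End QuadraticForm.

Lemma ord3_cases (x : 'I_3) : [\/ x = 0, x = 1 | x = 2].
Proof.
by case: x => [[|[|[|//]]]] ?; [constructor 1|constructor 2|constructor 3];
   apply/val_inj.
Qed.

Section Triangle.
Variables (R : realType) (t : 'I_3 -> plane R).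
Hypothesis t_nondeg : nondegenerate_triangle t.

(** A repeated vertex gives [edge_mx t] a zero column or two equal columns, so its determinant
    vanishes. *)
Lemma nondegenerate_triangle_inj : injective t.
Proof.
have : \det (edge_mx t) != 0 by rewrite -unitfE -unitmxE.
rewrite det_mx22 !mxE => dn0 a b tab; apply/eqP; apply: contraNT dn0.
pose s i r := t i r 0; have sab r : s a r = s b r by rewrite /s tab.
have l0 : lift ord0 (0 : 'I_2) = 1 :> 'I_3 by apply/val_inj.
have l1 : lift ord0 (1 : 'I_2) = 2 :> 'I_3 by apply/val_inj.
rewrite l0 l1 -!/(s _ _) -[ord0]/(0 : 'I_3).
have s0 := sab 0; have s1 := sab 1.
by move: s0 s1; case: (ord3_cases a) => ->; case: (ord3_cases b) => -> //= s0 s1 _;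
   rewrite ?s0 ?s1 -?s0 -?s1; apply/eqP; ring.
Qed.

(* Rotating by a right angle turns D into its adjugate, and maps the edge
   opposite to a vertex onto a multiple of the q-vector of that vertex. *)
Lemma dotM_invmx_edges (D : 'M[R]_2) (a b c : 'I_3) :
    \det D != 0 -> D 1 0 = D 0 1 -> uniq [:: a; b; c] ->
  dotM (invmx D) (t a - t c) (t b - t c)
  = - (\det (edge_mx t) ^+ 2 / \det D) * dotM D (q_vec t a) (q_vec t b).
Proof.
move=> D0 Ds abc.
have dn0 : \det (edge_mx t) != 0 by rewrite -unitfE -unitmxE.
rewrite !dotM2E; have [-> -> -> ->] := invmx2E D0.
have [q00 q01 q10 q11] := invmx2E dn0.
have l0 : lift ord0 (0 : 'I_2) = 1 :> 'I_3 by apply/val_inj.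
have l1 : lift ord0 (1 : 'I_2) = 2 :> 'I_3 by apply/val_inj.
have l1' : lift ord0 (ord0 : 'I_1) = 1 :> 'I_2 by apply/val_inj.
have qE1 r : q_vec t 1 r 0 = invmx (edge_mx t) 0 r.
  by rewrite /q_vec -l0 liftK !mxE.
have qE2 r : q_vec t 2 r 0 = invmx (edge_mx t) 1 r.
  by rewrite /q_vec -l1 liftK !mxE.
have qE0 r : q_vec t 0 r 0 = - (invmx (edge_mx t) 0 r + invmx (edge_mx t) 1 r).
  by rewrite /q_vec unlift_none !big_ord_recl big_ord0 addr0 !mxE l1'.
move: dn0 D0 abc; rewrite !mxE.
(* Only the six orderings of distinct indices survive; in coordinates each is a rational identity
   with denominators [\det D] and [\det (edge_mx t)]. *)
case: (ord3_cases a) => ->; case: (ord3_cases b) => ->; case: (ord3_cases c) => -> // dn0 D0 _;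
  rewrite ?qE0 ?qE1 ?qE2 ?q00 ?q01 ?q10 ?q11;
  move: dn0 D0; rewrite !det_mx22 !mxE l0 l1 -[ord0]/(0 : 'I_3) Ds => dn0 D0;
  field; by rewrite D0 dn0.
Qed.

Lemma nonobtuse_dot_ge0 (D : 'M[R]_2) (a b c : 'I_3) :
    spd D -> uniq [:: a; b; c] -> dotM D (q_vec t a) (q_vec t b) <= 0 ->
  0 <= dotM (invmx D) (t a - t c) (t b - t c).
Proof.
move=> Dspd abc qle0; have Dd := spd_det2_gt0 Dspd.
rewrite dotM_invmx_edges ?gt_eqF ?spd_sym2 // mulr_le0 // oppr_le0.
by rewrite divr_ge0 ?sqr_ge0 // ltW.
Qed.

End Triangle.

Section Angle.
Variable R : realType.

Lemma angle_bounds (M : 'M[R]_2) (p q r : plane R) :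
    spd M -> 0 <= dotM M (p - r) (q - r) ->
  angle M p q r <= pi / 2 /\ 0 <= cot (angle M p q r).
Proof.
move=> Mspd d0; rewrite /angle; set x := _ / _.
have n0 : 0 <= normM M (p - r) * normM M (q - r) by rewrite mulr_ge0 ?sqrtr_ge0.
have x0 : 0 <= x by rewrite divr_ge0.
have x1 : x <= 1.
  (* The points are arbitrary here, so the product of norms may be 0; then [x] is 0, since the
     inverse of 0 is 0. *)
  move: n0; rewrite le0r /x => /orP[/eqP->|n0]; first by rewrite invr0 mulr0.
  by rewrite ler_pdivrMr // mul1r spd_dot_le_norm2.
have x11 : -1 <= x <= 1 by rewrite x1 andbT (le_trans _ x0) // lerN10.
have cosx : cos (acos x) = x by apply: acosK; rewrite in_itv.
have ax0 := acos_ge0 x11; have axpi := acos_lepi x11.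
(* When [x] is 1 the sine vanishes and the quotient is 0 by the same convention, so the cotangent
   bound survives. *)
split; last by rewrite /cot cosx divr_ge0 // sin_ge0_pi // ax0.
rewrite leNgt; apply/negP => ax.
(* Cosine decreases strictly on [0, pi], so an angle beyond pi/2 would make [x] negative. *)
have : cos (acos x) < cos (pi / 2).
  by rewrite ltr_cos // in_itv /= ?ax0 ?axpi //; have := pi_ge0 R; lra.
by rewrite cosx cos_pihalf ltNge x0.
Qed.

Lemma arccot_le_pihalf (x : R) : 0 <= x -> arccot x <= pi / 2.
Proof. by move=> x0; rewrite /arccot lerBlDr lerDl -(atan0 R) le_atan. Qed.

End Angle.

(** Passes from global vertex numbers to local ones: an element stores its vertices in an arbitrary
    order, whereas the q-vectors are indexed by local position. *)
Lemma verts_edge_opposite n (K : {ffun 'I_3 -> 'I_n}) (i j k : 'I_n) :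
    injective K -> i != j -> verts K = [set i; j; k]%SET ->
  exists a b c, [/\ uniq [:: a; b; c], K a = i, K b = j & K c = k].
Proof.
move=> Kinj ij KE.
have K_ x : x \in [set i; j; k]%SET -> exists l, K l = x.
  by rewrite -KE => /imsetP[l _ ->]; exists l.
have [a Ka] : exists l, K l = i by apply: K_; rewrite !inE eqxx.
have [b Kb] : exists l, K l = j by apply: K_; rewrite !inE eqxx orbT.
have ab : a != b by apply: contra ij => /eqP ab; rewrite -Ka -Kb ab.
have /card_gt0P[c] : (0 < #|~: [set a; b]%SET|)%N.
  by rewrite cardsCs finset.setCK card_ord cards2 ab.
rewrite !inE negb_or => /andP[ca cb].
exists a, b, c; split=> //.
  by rewrite /= !inE negb_or ab ![_ == c]eq_sym ca cb.
(* Injectivity separates [K c] from [i] and [j], which leaves only [k]. *)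
have: K c \in verts K by apply/imsetP; exists c.
rewrite KE !inE -Ka -Kb !(inj_eq Kinj) (negPf ca) (negPf cb) /=.
by move/eqP.
Qed.

Theorem mainTheorem2 (R : realType)
  (Omega : set (plane R)) (hOmega : polygonal_domain Omega)
  (T : mesh R) (hT : conforming_triangulation Omega T)
  (ahat : 'I_3 -> plane R) (hahat : nondegenerate_triangle ahat)
  (m : nat) (bhat : 'I_m -> plane R) (w : 'I_m -> R)
  (hbhat : forall k, triangle ahat (bhat k))
  (hw : forall k, 0 <= w k) (hw1 : \sum_k w k = 1)
  (F : {ffun 'I_3 -> 'I_(nvtx T)} -> plane R -> plane R)
  (hF : forall K, K \in elts T ->
     affine_map (F K) /\ F K @` triangle ahat = triangle (eltpts K))
  (D : plane R -> 'M[R]_2)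
  (hD : forall x, Omega x -> spd (D x))
  (hDb : forall K k, K \in elts T -> spd (D (F K (bhat k))))
  (hobt : forall K, K \in elts T -> forall i j : 'I_3, i != j ->
     dotM (avg_diff D w bhat (F K)) (q_vec (eltpts K) i) (q_vec (eltpts K) j)
       <= 0)
  (K K' : {ffun 'I_3 -> 'I_(nvtx T)})
  (hK : K \in elts T) (hK' : K' \in elts T) (hKK' : K != K')
  (i j k k' : 'I_(nvtx T)) (hij : i != j)
  (hKijk : verts K = [set i; j; k]%SET)
  (hK'ijk : verts K' = [set i; j; k']%SET) :
  let DK := avg_diff D w bhat (F K) in
  let DK' := avg_diff D w bhat (F K') in
  let alpha := angle (invmx DK) (vtx i) (vtx j) (vtx k) in
  let alpha' := angle (invmx DK') (vtx i) (vtx j) (vtx k') in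
  1 / 2 * (alpha + alpha'
           + arccot (Num.sqrt (\det DK / \det DK') * cot alpha)
           + arccot (Num.sqrt (\det DK' / \det DK) * cot alpha')) <= pi.
Proof.
cbv zeta; set DK := avg_diff D w bhat (F K); set DK' := avg_diff D w bhat (F K').
set alpha := angle (invmx DK) _ _ _; set alpha' := angle (invmx DK') _ _ _.
(* The two elements play symmetric roles, so both angles are bounded through one statement. *)
have bounds L l : L \in elts T -> verts L = [set i; j; l]%SET ->
    let a := angle (invmx (avg_diff D w bhat (F L))) (vtx i) (vtx j) (vtx l) in
    a <= pi / 2 /\ 0 <= cot a.
  move=> hL LE.
  have Lnd : nondegenerate_triangle (eltpts L) by case: hT => _ _ + _ _; apply.
  have Linj : injective L.
    by move=> x y Lxy; apply: (nondegenerate_triangle_inj Lnd); rewrite /eltpts Lxy.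
  have Dspd : spd (avg_diff D w bhat (F L)).
    by apply: spd_avg => // x; exact: hDb.
  have [a [b [c [abc <- <- <-]]]] := verts_edge_opposite Linj hij LE.
  apply: angle_bounds; first exact: spd_invmx2.
  apply: (nonobtuse_dot_ge0 Lnd Dspd abc); apply: hobt => //.
  by move: abc; rewrite /= !inE negb_or => /andP[/andP[]].
have [a1 c1] : alpha <= pi / 2 /\ 0 <= cot alpha by exact: bounds hKijk.
have [a2 c2] : alpha' <= pi / 2 /\ 0 <= cot alpha' by exact: bounds hK'ijk.
(* The determinant ratio enters as a nonnegative factor, so the argument of [arccot] stays
   nonnegative. *)
have r1 : arccot (Num.sqrt (\det DK / \det DK') * cot alpha) <= pi / 2.
  by rewrite arccot_le_pihalf // mulr_ge0 ?sqrtr_ge0.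
have r2 : arccot (Num.sqrt (\det DK' / \det DK) * cot alpha') <= pi / 2.
  by rewrite arccot_le_pihalf // mulr_ge0 ?sqrtr_ge0.
lra.
Qed.
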